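(* Let $n$ be a positive integer and let $\mathcal{V}(Z(n))=B_1\times\cdots\times B_s$ be the associated multivector of its Zeckendorf 2-partition. Then \[F(n;t)=D(B_1;t)\,D(B_2;t)\cdots D(B_s;t).\]
   Context: Let $f_0=f_1=1$ and $f_i=f_{i-1}+f_{i-2}$ for $i\ge 2$ (so $f_1=1,f_2=2,f_3=3,f_4=5,\dots$). A Fibonacci partition of $n\in\mathbb{N}=\{0,1,2,\dots\}$ is a finite set $\{f_{i_1},\dots,f_{i_h}\}$ with $1\le i_1<\dots<i_h$ and $f_{i_1}+\dots+f_{i_h}=n$; $h$ is its number of parts. $F_h(n)$ denotes the number of Fibonacci partitions of $n$ with $h$ parts, and $F(n;t)=\sum_{h\ge 0}F_h(n)t^h$ (with $F_0(0)=1$ and $F_0(n)=0$ for $n>0$). For an integer $m$, $\lambda(m)\in\{0,1\}$ is $m\bmod 2$. A 2-partition is a finite set of integers $I=\{i_1<\dots<i_q\}$ with $i_1\ge 1$ and $i_{a+1}-i_a\ge 2$ for all $a$. By Zeckendorf's theorem each $n\in\mathbb{N}$ has a unique representation $n=f_{\mu_1(n)}+\dots+f_{\mu_q(n)}$ with $Z(n)=\{\mu_1(n)<\dots<\mu_q(n)\}$ a 2-partition. A 2-partition is simple if all its elements have the same parity. The canonical form of a nonempty 2-partition $I$ is the unique decomposition $I=I_1\cup\dots\cup I_s$ into simple 2-partitions with $\max I_a<\min I_{a+1}$ and $\min(I_{a+1})-\max(I_a)$ odd for $a=1,\dots,s-1$ (i.e. $I$ is cut into maximal runs of consecutive elements of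 equal parity). The associated vector of $I=\{i_1<\dots<i_q\}$ is $(\alpha_1,\dots,\alpha_q)$ with $\alpha_1=\lfloor (i_1-1)/2\rfloor+1$ and $\alpha_r=\lfloor (i_r-i_{r-1})/2\rfloor+1$ for $r>1$. Writing $d_0=0$, $d_m=|I_1|+\dots+|I_m|$, let $B_m=(\alpha_{d_{m-1}+1},\dots,\alpha_{d_m})$; the associated multivector is $\mathcal{V}(I)=B_1\times\cdots\times B_s$. For $\alpha\in\mathbb{N}$ let $\phi_\alpha(t)=t+t^2+\dots+t^\alpha$. For an integer vector $(\alpha_1,\dots,\alpha_r)$ the polynomial $D(\alpha_1,\dots,\alpha_r;t)$ is defined by $D(\emptyset;t)=1$, $D(\alpha_1;t)=\phi_{\alpha_1}(t)$ and for $r\ge 2$ \[D(\alpha_1,\dots,\alpha_r;t)=\phi_{\alpha_r}(t)D(\alpha_1,\dots,\alpha_{r-1};t)-t^{\alpha_r+1}D(\alpha_1,\dots,\alpha_{r-2};t).\] *)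

(* Defs.v *)
From mathcomp Require Import all_boot all_order all_algebra.

Set Implicit Arguments.
Unset Strict Implicit.
Unset Printing Implicit Defensive.

Import GRing.Theory.

Fixpoint fib (n : nat) : nat :=
  match n with
  | 0 => 1
  | n1.+1 => match n1 with
             | 0 => 1
             | n2.+1 => fib n1 + fib n2
             end
  end.

Arguments fib : simpl never.

Lemma fibSS n : fib n.+2 = fib n.+1 + fib n. Proof. by []. Qed.

Lemma fib_gt0 n : 0 < fib n.
Proof.
suff /andP[] : (0 < fib n) && (0 < fib n.+1) by [].
by elim: n => [|n /andP[h1 h2]] //; rewrite h2 fibSS addn_gt0 h2.
Qed.

Lemma leq_fib n : n <= fib n.
Proof.
suff /andP[] : (n <= fib n) && (n.+1 <= fib n.+1) by [].
elim: n => [|n /andP[h1 h2]] //; rewrite h2 fibSS /=.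
by rewrite -addn1 leq_add // fib_gt0.
Qed.

(** A Fibonacci partition is a set of numbers [fib i] with [1 <= i]. The parts
    live in ['I_n.+1] because each part is at most the sum [n]; the index [i]
    may be bounded by [n] as well, since [i <= fib i] (lemma [leq_fib]). *)
Definition fib_partitions (n : nat) : {set {set 'I_n.+1}} :=
  [set P : {set 'I_n.+1} |
    [forall x in P, [exists i : 'I_n.+1, (0 < i) && (fib i == x)]]
    && (\sum_(x in P) (x : nat) == n)].

Definition fib_count (h n : nat) : nat :=
  #|[set P in fib_partitions n | #|P| == h]|.

(** The generating polynomial; a partition of [n] has at most [n] parts, so the
    truncation loses nothing (lemma [coef_fib_gf]). *)
Definition fib_gf (n : nat) : {poly int} :=
  (\poly_(h < n.+1) (fib_count h n)%:R)%R.

Lemma fib_count_eq0 h n : n < h -> fib_count h n = 0.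
Proof.
move=> lt_nh; apply/eqP; rewrite cards_eq0; apply/eqP/setP => P.
rewrite !inE; apply/negP => /andP[/andP[/forall_inP Pfib /eqP sumP] /eqP cardP].
suff: #|P| <= \sum_(x in P) (x : nat) by rewrite sumP cardP leqNgt lt_nh.
rewrite -sum1_card; apply: leq_sum => x /Pfib /existsP[i /andP[_ /eqP <-]]; exact: fib_gt0.
Qed.

Lemma coef_fib_gf h n : ((fib_gf n)`_h = (fib_count h n)%:R)%R.
Proof.
by rewrite coef_poly; case: ltnP => // /fib_count_eq0 ->.
Qed.

(** Finite sets of integers are represented by increasing sequences. *)
Definition two_partition (I : seq nat) : bool :=
  all (leq 1) I && sorted (fun i j => i.+2 <= j) I.

Definition zeckendorf_of (n : nat) (I : seq nat) : bool :=
  two_partition I && (\sum_(i <- I) fib i == n).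

Lemma two_partition_rcons I i :
  two_partition (rcons I i)
  = [&& 0 < i, all (fun j => j.+2 <= i) I & two_partition I].
Proof.
have tr : transitive (fun i j : nat => i.+2 <= j).
  by move=> b a c ab bc; apply: leq_trans ab (leq_trans _ bc); rewrite ltnW.
rewrite /two_partition !sorted_pairwise // pairwise_rcons all_rcons -!andbA.
by congr andb; rewrite andbCA.
Qed.

Lemma zeckendorf_bounded k n : n < fib k.+1 ->
  exists2 I, all (fun j => j <= k) I & zeckendorf_of n I.
Proof.
elim/ltn_ind: k n => -[|[|k]] IH n lt_n.
- by exists [::] => //; rewrite /zeckendorf_of big_nil; case: n lt_n.
- case: n lt_n => [|[|n]] // _.
    by exists [::] => //; rewrite /zeckendorf_of big_nil.
  by exists [:: 1] => //; rewrite /zeckendorf_of big_seq1.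
- have [lt2|le2] := ltnP n (fib k.+2).
    have [I Ik ZI] := IH k.+1 (ltnSn _) _ lt2.
    by exists I => //; apply: sub_all Ik => j /leqW.
  have lt1 : n - fib k.+2 < fib k.+1.
    by rewrite ltn_subLR // addnC addnC -fibSS.
  have [I Ik /andP[I2 /eqP sI]] := IH k (leqnSn _) _ lt1.
  exists (rcons I k.+2).
    by rewrite all_rcons leqnn /=; apply: sub_all Ik => j /leqW/leqW.
  rewrite /zeckendorf_of two_partition_rcons I2 andbT /=.
  by rewrite (sub_all _ Ik) // -cats1 big_cat big_seq1 /= sI subnK.
Qed.

Lemma zeckendorf_exists n : exists I, zeckendorf_of n I.
Proof.
have [|I _ ZI] := @zeckendorf_bounded n n; last by exists I.
exact: leq_fib n.+1.
Qed.

(** [Z(n)]: the representation given by Zeckendorf's theorem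
    (see [zeckendorfP] and [zeckendorf_unique]). *)
Definition zeckendorf (n : nat) : seq nat := xchoose (zeckendorf_exists n).

Lemma zeckendorfP n : zeckendorf_of n (zeckendorf n).
Proof. exact: xchooseP. Qed.

Lemma two_partition_sum_lt k I : two_partition I ->
  all (fun j => j <= k) I -> \sum_(i <- I) fib i < fib k.+1.
Proof.
elim/ltn_ind: k I => k IH I; case/lastP: I => [|I i].
  by rewrite big_nil fib_gt0.
rewrite two_partition_rcons all_rcons => /and3P[i0 Ii I2] /andP[ik Ik].
rewrite -cats1 big_cat big_seq1 /=.
case: k i i0 ik Ii IH Ik => [|k] [|i] // _ ik Ii IH Ik.
have [lt_ik|le_ki] := ltnP i k.
  have := IH k (ltnSn k) (rcons I i.+1).
  rewrite two_partition_rcons I2 Ii /= all_rcons lt_ik -cats1 big_cat big_seq1 /=.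
  move=> H; apply: leq_trans (leq_addr _ _); apply: H => //.
  by apply: sub_all Ii => j; rewrite ltnS => ji; exact: ltnW (ltn_trans ji lt_ik).
have -> : i = k by apply/eqP; rewrite eqn_leq le_ki -ltnS ik.
rewrite fibSS addnC ltn_add2l.
have {le_ki}eik : i = k by apply/eqP; rewrite eqn_leq le_ki -ltnS ik.
case: k IH Ik ik eik => [|k] IH _ _ eik; subst i.
  by case: I Ii {I2} => [|j I] //; rewrite big_nil.
by apply: IH => //; rewrite ltnW.
Qed.

Lemma zeckendorf_unique n I : zeckendorf_of n I -> I = zeckendorf n.
Proof.
suff uniqZ J1 J2 : two_partition J1 -> two_partition J2 ->
    \sum_(i <- J1) fib i = \sum_(i <- J2) fib i -> J1 = J2.
  move=> /andP[I2 /eqP sI]; have /andP[Z2 /eqP sZ] := zeckendorfP n.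
  by apply: uniqZ; rewrite ?sI ?sZ.
have le_top K1 i K2 j : two_partition (rcons K1 i) ->
    two_partition (rcons K2 j) -> \sum_(a <- rcons K1 i) fib a =
    \sum_(a <- rcons K2 j) fib a -> j <= i.
  rewrite [two_partition (rcons K2 j)]two_partition_rcons => P1 /and3P[j0 _ _].
  move=> eqs; rewrite leqNgt; apply/negP => lt_ij.
  case: j j0 lt_ij eqs => // j _ lt_ij eqs.
  have := @two_partition_sum_lt j _ P1; rewrite eqs all_rcons -cats1 big_cat big_seq1 /=.
  rewrite ltnS in lt_ij; rewrite lt_ij ltnNge leq_addl => H.
  suff /H : all (fun a => a <= j) K1 by [].
  move: P1; rewrite two_partition_rcons => /and3P[_ K1i _].
  apply: sub_all K1i => a ai; apply: leq_trans (ltnW (ltnW ai)) _.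
  exact: lt_ij.
elim/last_ind: J1 J2 => [|J1 i IH] J2; case/lastP: J2 => [|J2 j] //.
- by move=> _ _ /eqP; rewrite big_nil -cats1 big_cat big_seq1 /= eq_sym
    addn_eq0 [fib j == 0]eqn0Ngt fib_gt0 andbF.
- by move=> _ _ /eqP; rewrite big_nil -cats1 big_cat big_seq1 /=
    addn_eq0 [fib i == 0]eqn0Ngt fib_gt0 andbF.
move=> P1 P2 eqs.
have eij : i = j.
  by apply/eqP; rewrite eqn_leq (le_top _ _ _ _ P1 P2 eqs)
    (le_top _ _ _ _ P2 P1 (esym eqs)).
move: P1 P2 eqs; rewrite eij !two_partition_rcons -!cats1 !big_cat !big_seq1 /=.
move=> /and3P[_ _ P1] /and3P[_ _ P2] /eqP; rewrite eqn_add2r => /eqP eqs.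
by rewrite (IH _ P1 P2 eqs).
Qed.

Definition same_parity (I : seq nat) : bool :=
  all (fun i => all (fun j => odd i == odd j) I) I.

Definition simple (I : seq nat) : bool := two_partition I && same_parity I.

Definition is_canonical_form (I : seq nat) (Is : seq (seq nat)) : Prop :=
  [/\ flatten Is = I,
      all (fun J => J != [::]) Is,
      all simple Is
    & sorted (fun J K => (last 0 J < head 0 K) && odd (head 0 K - last 0 J)) Is].

(** Cuts [I] into maximal runs of consecutive elements of equal parity; this is
    the unique canonical form (lemmas [canonical_formP], [canonical_form_unique]). *)
Fixpoint canonical_form (I : seq nat) : seq (seq nat) :=
  if I is i :: I' then
    match canonical_form I' with
    | (j :: J) :: Js => if odd i == odd j then (i :: j :: J) :: Js
                        else [:: i] :: (j :: J) :: Js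
    | _ => [:: [:: i]]
    end
  else [::].

Lemma canonical_form_runs Is :
  all (fun J => J != [::]) Is -> all same_parity Is ->
  sorted (fun J K => odd (last 0 J) != odd (head 0 K)) Is ->
  canonical_form (flatten Is) = Is.
Proof.
elim: Is => [|J Is IH] //= /andP[J0 Is0] /andP[Jp Isp] Iss.
have {}IH := IH Is0 Isp (path_sorted Iss).
elim: J J0 Jp Iss => [|i [|j J] IHJ] //= _.
  move=> _; rewrite IH; case: Is {IH IHJ} Is0 Isp => [|[|k K] Is] //= _ _.
  by move=> /andP[/negbTE ->].
move=> Jp Iss; rewrite /= in IHJ.
rewrite IHJ //; last by case: {Is0 Isp IH IHJ} Is Iss.
  by move: Jp => /andP[/and3P[_ -> _] _].
apply/allP => a aJ; apply/allP => b bJ.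
have /allP /(_ a) := Jp; rewrite inE aJ orbT => /(_ isT).
by move/allP/(_ b); rewrite inE bJ orbT => /(_ isT).
Qed.

Lemma canonical_form_unique I Is :
  is_canonical_form I Is -> Is = canonical_form I.
Proof.
case=> <- Is0 Iss IsS; rewrite canonical_form_runs //.
  by apply: sub_all Iss => J /andP[].
apply: sub_sorted IsS => J K /andP[lt_JK]; rewrite oddB; last exact: ltnW.
by case: odd; case: odd.
Qed.

Lemma canonical_formP I :
  two_partition I -> is_canonical_form I (canonical_form I).
Proof.
elim: I => [|i I IH] // /andP[/= /andP[i0 I0] Is].
have {IH}[fI Ine Isim Isep] : is_canonical_form I (canonical_form I).
  by apply: IH; rewrite /two_partition I0 (path_sorted Is).
have i1 : simple [:: i] by rewrite /simple /two_partition /same_parity /= i0 eqxx.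
case: (canonical_form I) fI Ine Isim Isep => [|[|j J] Js] //=.
  by move=> <- _ _ _; split; rewrite //= i1.
move=> eI; rewrite -{}eI /= in I0 Is *; move: Is => /andP[ij _].
move=> Jne /andP[Jsim Jssim] Jsep; case: eqP => [eij|/eqP nij]; split => //=.
- apply/andP; split=> //; move: Jsim => /andP[/andP[Jpos Jst] Jpar].
  rewrite /simple /two_partition /= i0 ij -[_ && all _ J]/(all (leq 1) (j :: J)).
  rewrite Jpos (Jst : path _ j J) /=.
  have iJ a : a \in j :: J -> odd i == odd a.
    by move=> aJ; rewrite eij; move/allP: Jpar => /(_ j (mem_head _ _)) /allP ->.
  apply/allP => a; rewrite inE => aiJ; apply/allP => b; rewrite inE => biJ.
  have -> : odd a = odd i by case/predU1P: aiJ => [->|/iJ /eqP].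
  by case/predU1P: biJ => [->|/iJ].
- by case: {I0 Jne Jssim} Js Jsep.
- by rewrite i1 Jsim.
- by rewrite Jsep (ltnW ij) /= oddB ?(ltnW (ltnW ij)) // andbT addbC -negb_eqb.
Qed.

Definition assoc_vector (I : seq nat) : seq nat :=
  if I is i :: I' then
    (i - 1)./2.+1 :: pairmap (fun a b => (b - a)./2.+1) i I'
  else [::].

Definition multivector (I : seq nat) : seq (seq nat) :=
  reshape (shape (canonical_form I)) (assoc_vector I).

Local Open Scope ring_scope.

Definition phi (a : nat) : {poly int} := \sum_(1 <= i < a.+1) 'X^i.

(** The recurrence for [D] removes entries from the right end, hence the
    recursion on the reversed vector (see [D_nil], [D_seq1], [D_rcons2]). *)
Fixpoint Drev (s : seq nat) : {poly int} :=
  match s with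
  | [::] => 1
  | a :: s1 => match s1 with
               | [::] => phi a
               | b :: s2 => phi a * Drev s1 - 'X^(a.+1) * Drev s2
               end
  end.

Definition D (s : seq nat) : {poly int} := Drev (rev s).

Lemma D_nil : D [::] = 1. Proof. by []. Qed.

Lemma D_seq1 a : D [:: a] = phi a. Proof. by []. Qed.

Lemma D_rcons2 s b a :
  D (rcons (rcons s b) a) = phi a * D (rcons s b) - 'X^(a.+1) * D s.
Proof. by rewrite /D !rev_rcons. Qed.

(* Main.v *)
(** Let [i] be the largest Zeckendorf index of [n] and [n' = n - fib i]. A
    partition of [n] either uses [fib i], leaving a partition of [n'], or it must
    use [fib i.-1], which leaves [fib i.-2 + n'] to be written with parts below
    [fib i.-1]. Iterating this descends from [i] in steps of two until the next
    Zeckendorf index [j] is met. If [i - j] is odd the descent stops at [j.+1] and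
    the polynomial of [n'] simply gets multiplied by a [phi]; if [i - j] is even
    it reaches [2 * fib j + n''], which produces the correction term in the
    recurrence of [D]. Hence each run of equal parity contributes one factor [D],
    and a change of parity starts a new factor. *)
Require Import Defs.
From mathcomp Require Import all_boot all_order all_algebra.
From mathcomp Require Import zify ring.

Import GRing.Theory.

Local Open Scope ring_scope.

(** * Elementary facts on Fibonacci numbers and on [phi] *)

Lemma leq_fibS k : (fib k <= fib k.+1)%N.
Proof. by case: k => [|k] //; rewrite fibSS leq_addr. Qed.

Lemma leq_fib2 j k : (j <= k)%N -> (fib j <= fib k)%N.
Proof.
elim: k => [|k IH]; first by rewrite leqn0 => /eqP ->.
rewrite leq_eqVlt => /predU1P[-> //|/IH le_jk].
exact: leq_trans le_jk (leq_fibS k).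
Qed.

Lemma ltn_fibS k : (fib k.+1 < fib k.+2)%N.
Proof. by rewrite fibSS -[X in (X < _)%N]addn0 ltn_add2l fib_gt0. Qed.

Lemma phiS k : phi k.+1 = 'X + 'X * phi k.
Proof.
rewrite /phi big_ltn // big_add1 /= mulr_sumr expr1; congr (_ + _).
by apply: eq_bigr => i _; rewrite exprS.
Qed.

Lemma phiSr k : phi k.+1 = phi k + 'X^(k.+1).
Proof. by rewrite /phi big_nat_recr. Qed.

(** * Partitions with bounded parts, as sets and by recursion *)

(** [fib_gf_upto k m] is the generating polynomial of the Fibonacci partitions
    of [m] whose parts are among [fib 1, ..., fib k]. *)
Fixpoint fib_gf_upto (k m : nat) : {poly int} :=
  if k is k'.+1 then
    fib_gf_upto k' m +
      (if (fib k <= m)%N then 'X * fib_gf_upto k' (m - fib k) else 0)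
  else (m == 0%N)%:R.

Lemma fib_gf_uptoS k m : fib_gf_upto k.+1 m = fib_gf_upto k m +
  (if (fib k.+1 <= m)%N then 'X * fib_gf_upto k (m - fib k.+1) else 0).
Proof. by []. Qed.

Definition fib_parts (k : nat) : seq nat := [seq fib i | i <- iota 1 k].

Lemma mem_fib_partsS k x :
  (x \in fib_parts k.+1) = (x == fib k.+1) || (x \in fib_parts k).
Proof. by rewrite /fib_parts -[k.+1]addn1 iotaD map_cat mem_cat orbC addnC /= inE. Qed.

Lemma fib_parts_lt k x : x \in fib_parts k -> (x < fib k.+1)%N.
Proof.
case/mapP => i; rewrite mem_iota add1n ltnS => /andP[i_gt0 le_ik] ->.
case: k le_ik => [|k] le_ik; first by case: i i_gt0 le_ik.
exact: leq_ltn_trans (leq_fib2 _ _ le_ik) (ltn_fibS k).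
Qed.

(** The ambient [n] is kept apart from the sum [m], which drops in the recursion while the type
    ['I_n.+1] stays fixed. *)
Definition fib_partition_upto (n k m : nat) (P : {set 'I_n.+1}) : bool :=
  [forall x in P, val x \in fib_parts k] && (\sum_(x in P) (x : nat) == m)%N.

Lemma fib_partition_upto_notin n k m (x : 'I_n.+1) (P : {set 'I_n.+1}) :
  fib k.+1 = x -> fib_partition_upto n k m P -> x \notin P.
Proof.
move=> ex /andP[/forall_inP Pk _]; apply/negP => /Pk /fib_parts_lt.
by rewrite ex ltnn.
Qed.

Lemma fib_partition_uptoS_notin n k m (x : 'I_n.+1) (P : {set 'I_n.+1}) : fib k.+1 = x ->
  fib_partition_upto n k.+1 m P && (x \notin P) = fib_partition_upto n k m P.
Proof.
move=> ex; apply/idP/idP => [/andP[/andP[/forall_inP Pk sP] xP]|kP].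
  apply/andP; split=> //; apply/forall_inP => y yP.
  have := Pk y yP; rewrite mem_fib_partsS ex => /predU1P[/val_inj eyx|//].
  by rewrite -eyx yP in xP.
rewrite (fib_partition_upto_notin _ _ _ _ _ ex kP) andbT.
case/andP: kP => /forall_inP Pk sP; apply/andP; split=> //.
by apply/forall_inP => y /Pk yk; rewrite mem_fib_partsS yk orbT.
Qed.

Lemma fib_partition_uptoS_setU1 n k m (x : 'I_n.+1) (Q : {set 'I_n.+1}) : fib k.+1 = x ->
  x \notin Q -> fib_partition_upto n k.+1 m (x |: Q) =
    (x <= m)%N && fib_partition_upto n k (m - x) Q.
Proof.
move=> ex xQ; rewrite /fib_partition_upto big_setU1 //=.
have -> : [forall y in x |: Q, val y \in fib_parts k.+1] =
          [forall y in Q, val y \in fib_parts k].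
  apply/forall_inP/forall_inP => Qk y yQ.
    have := Qk y (setU1r _ yQ); rewrite mem_fib_partsS ex.
    by case/predU1P => [/val_inj eyx|//]; rewrite -eyx yQ in xQ.
  rewrite mem_fib_partsS ex; case/setU1P: yQ => [->|/Qk ->]; rewrite ?eqxx //.
  by rewrite orbT.
rewrite andbCA; congr (_ && _).
by apply/eqP/andP => [<-|[le_xm /eqP ->]]; rewrite ?leq_addr ?addKn ?subnKC.
Qed.

(** Partitions are split by whether they contain [fib k.+1]; deleting it matches those that do with
    partitions of [m - fib k.+1]. *)
Lemma sum_fib_partition_upto n k m : (m <= n)%N ->
  \sum_(P | fib_partition_upto n k m P) 'X^#|P| = fib_gf_upto k m.
Proof.
elim: k m => [|k IH] m le_mn /=.
  have only0 P : fib_partition_upto n 0 m P = (P == set0) && (m == 0%N).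
    apply/andP/andP => [[/forall_inP P0 sP]|[/eqP -> /eqP ->]].
      have eP : P = set0 by apply/setP => x; rewrite inE; apply/negP => /P0.
      by move: sP; rewrite eP big_set0 eq_sym.
    by rewrite big_set0; split=> //; apply/forall_inP => x; rewrite inE.
  rewrite (eq_bigl _ _ only0); case: (m == 0%N).
    by under eq_bigl do rewrite andbT; rewrite big_pred1_eq cards0.
  by rewrite big_pred0 // => P; rewrite andbF.
(* A part above [n] is absent from ['I_n.+1] and exceeds [m] as well. *)
have [lt_fib|le_fib] := leqP (fib k.+1) n; last first.
  rewrite leqNgt (leq_ltn_trans le_mn le_fib) addr0 -IH //.
  apply: eq_bigl => P; congr (_ && _); apply: eq_forallb => x.
  rewrite mem_fib_partsS; case: eqP => //= ex.
  by have := leq_ltn_trans (leq_ord x) le_fib; rewrite ex ltnn.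
pose x : 'I_n.+1 := Ordinal (lt_fib : (fib k.+1 < n.+1)%N).
have ex : fib k.+1 = x by [].
rewrite (bigID (fun P : {set 'I_n.+1} => x \in P)) /= addrC; congr (_ + _).
  rewrite -IH //; apply: eq_bigl => P; exact: fib_partition_uptoS_notin.
rewrite (reindex_onto (fun Q : {set 'I_n.+1} => x |: Q) (fun P => P :\ x)) /=; last first.
  by move=> P /andP[_ xP]; rewrite setD1K.
rewrite (eq_bigl (fun Q => (x <= m)%N && fib_partition_upto n k (m - x) Q)).
  have [le_xm|_] := leqP x m; last by rewrite big_pred0.
  rewrite -IH ?(leq_trans (leq_subr _ _)) // mulr_sumr.
  apply: eq_bigr => Q kQ.
  by rewrite cardsU1 (fib_partition_upto_notin _ _ _ _ _ ex kQ) exprS.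
(* If [x] lies in [Q], then [(x |: Q) :\ x] differs from [Q], and [Q] has a part too large for the
   right side. *)
move=> Q; have [xQ|xQ] := boolP (x \in Q); last first.
  by rewrite fib_partition_uptoS_setU1 // setU11 setU1K // eqxx !andbT.
rewrite (negbTE (_ : _ != Q)) ?andbF; last first.
  by apply/eqP => /setP/(_ x); rewrite xQ !inE eqxx.
apply/esym/negP => /andP[_ kQ].
by have := fib_partition_upto_notin _ _ _ _ _ ex kQ; rewrite xQ.
Qed.

Lemma fib_gfE n : fib_gf n = fib_gf_upto n n.
Proof.
rewrite -(sum_fib_partition_upto n n n (leqnn n)).
have eP P : fib_partition_upto n n n P = (P \in fib_partitions n).
  rewrite inE; congr (_ && _); apply: eq_forallb => x; congr (_ ==> _).
  apply/mapP/existsP => [[i]|[i /andP[i_gt0 /eqP ex]]].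
    rewrite mem_iota add1n => /andP[i_gt0 lt_in] ex.
    by exists (Ordinal lt_in); rewrite i_gt0 /= -ex.
  by exists (val i) => //; rewrite mem_iota i_gt0 add1n /=.
rewrite (eq_bigl _ _ eP); apply/polyP => h; rewrite coef_fib_gf coef_sum.
under eq_bigr do rewrite coefXn.
rewrite /fib_count -sum1_card natr_sum big_mkcond [RHS]big_mkcond /=.
apply: eq_bigr => P _; rewrite !inE [h == _]eq_sym.
by case: (_ == h); rewrite ?andbT ?andbF ?if_same.
Qed.

(** * Vanishing and stability in the bound on the parts *)

(** The parts [fib 1, ..., fib k] add up to [fib k.+2 - 2] only. *)
Lemma fib_gf_upto_eq0 k m : (fib k.+2 <= m)%N -> fib_gf_upto k m = 0.
Proof.
elim: k m => [|k IH] m; first by case: m.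
rewrite fibSS => le_m; have := leq_fibS k.+1 => le_fib.
rewrite fib_gf_uptoS !IH; try lia.
by rewrite mulr0 if_same addr0.
Qed.

Lemma fib_gf_upto_stable k l m : (m < fib k.+1)%N -> (k <= l)%N ->
  fib_gf_upto l m = fib_gf_upto k m.
Proof.
move=> lt_m; elim: l => [|l IH]; first by rewrite leqn0 => /eqP ->.
rewrite leq_eqVlt => /predU1P[-> //|le_kl].
rewrite fib_gf_uptoS IH // leqNgt (leq_trans lt_m) ?addr0 //.
exact: leq_fib2.
Qed.

Lemma fib_gf_uptoE k m : (m < fib k.+1)%N -> fib_gf_upto k m = fib_gf m.
Proof.
move=> lt_m; rewrite fib_gfE -(fib_gf_upto_stable k (maxn k m)) ?leq_maxl //.
by apply: fib_gf_upto_stable; rewrite ?leq_maxr // leq_fib.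
Qed.

(** * Descent in steps of two *)

(** Either the part [fib i.+2] occurs, or [fib i.+1] must, since the smaller
    parts add up to less than [fib i.+2]. *)
Lemma fib_gf_upto_top i m : (m < fib i.+2)%N ->
  fib_gf_upto i.+2 (fib i.+2 + m) =
  'X * fib_gf m + 'X * fib_gf_upto i (fib i + m).
Proof.
move=> lt_m; rewrite fib_gf_uptoS leq_addr addKn (fib_gf_uptoE _ m) //.
have le_fib : (fib i.+1 <= fib i.+2 + m)%N by have := leq_fibS i.+1; lia.
rewrite fib_gf_uptoS le_fib fib_gf_upto_eq0 ?leq_addr //.
rewrite add0r addrC; congr (_ + 'X * fib_gf_upto _ _).
by rewrite fibSS; lia.
Qed.

(** The term ['X^r] of [phi k] comes from [r - 1] forced steps down followed by use of the current
    top part; the last summand comes from [k] forced steps. *)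
Lemma fib_gf_upto_topn i k m : (m < fib i.+2)%N ->
  fib_gf_upto (i + k.*2) (fib (i + k.*2) + m) =
  phi k * fib_gf m + 'X^k * fib_gf_upto i (fib i + m).
Proof.
move=> lt_m; elim: k => [|k IH].
  by rewrite double0 addn0 /phi big_geq // mul0r add0r mul1r.
rewrite doubleS !addnS fib_gf_upto_top; last first.
  by apply: leq_trans lt_m (leq_fib2 _ _ _); rewrite !ltnS leq_addr.
by rewrite IH phiS exprS; ring.
Qed.

Lemma fib_gf_addE i m : (fib i + m < fib i.+1)%N ->
  fib_gf (fib i + m) = fib_gf_upto i (fib i + m).
Proof. by move=> lt_im; rewrite fib_gf_uptoE. Qed.

Lemma fib_gf0 : fib_gf 0 = 1.
Proof. by rewrite fib_gfE. Qed.

Lemma fib_gf_fib i : (0 < i)%N -> fib_gf (fib i) = phi (i - 1)./2.+1.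
Proof.
case: i => // i _; rewrite subn1 /= -[fib i.+1]addn0 fib_gf_addE; last first.
  by rewrite addn0 ltn_fibS.
rewrite -[X in X.+1]odd_double_half -addSn fib_gf_upto_topn ?fib_gt0 // fib_gf0.
(* The descent ends at index 1 or 2, where the single part is the only choice. *)
have -> : fib_gf_upto (odd i).+1 (fib (odd i).+1 + 0) = 'X.
  case: (odd i).
    by rewrite -[LHS]/(0 + 'X * 0 + 'X * (1 + 0)) mulr0 !addr0 add0r mulr1.
  by rewrite -[LHS]/(0 + 'X * 1) add0r mulr1.
by rewrite mulr1 -exprSr phiSr.
Qed.

(** * Odd and even gaps below the largest index *)

Lemma fib_gf_odd_gap j k m : (m < fib j)%N ->
  fib_gf (fib (j.+1 + k.+1.*2.+1) + (fib j.+1 + m)) =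
  phi k.+2 * fib_gf (fib j.+1 + m).
Proof.
move=> lt_m; have lt_jm : (fib j.+1 + m < fib j.+2)%N by rewrite fibSS ltn_add2l.
have lt_jm2 := leq_trans lt_jm (leq_fibS _).
rewrite addnS -addSn fib_gf_addE; last first.
  rewrite doubleS !addnS [X in (_ < X)%N]fibSS ltn_add2l.
  by apply: leq_trans lt_jm (leq_fib2 _ _ _); lia.
rewrite fib_gf_upto_topn; last exact: leq_trans lt_jm2 (leq_fibS _).
(* Forcing [fib j.+1] at index [j.+2] would leave more than the parts up to [fib j] can supply. *)
rewrite fib_gf_upto_top // fib_gf_upto_eq0; last by rewrite fibSS; lia.
by rewrite (phiSr k.+1) !exprS; ring.
Qed.

(** When [fib j.+1] is needed a second time it can only come from the partitions
    of [fib j.+1 + m] that avoid it, whence the subtracted term. *)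
Lemma fib_gf_even_gap j k m : (m < fib j)%N ->
  fib_gf (fib (j.+1 + k.+1.*2) + (fib j.+1 + m)) =
  phi k.+2 * fib_gf (fib j.+1 + m) - 'X^(k.+3) * fib_gf m.
Proof.
move=> lt_m; have lt_jm : (fib j.+1 + m < fib j.+2)%N by rewrite fibSS ltn_add2l.
have gf_avoid : fib_gf_upto j (fib j.+1 + m) =
    fib_gf (fib j.+1 + m) - 'X * fib_gf m.
  rewrite (fib_gf_addE _ _ lt_jm) fib_gf_uptoS leq_addr addKn.
  by rewrite (fib_gf_uptoE j m) ?addrK // (leq_trans lt_m (leq_fibS _)).
rewrite fib_gf_addE; last first.
  rewrite doubleS !addnS [X in (_ < X)%N]fibSS ltn_add2l.
  by apply: leq_trans lt_jm (leq_fib2 _ _ _); lia.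
rewrite fib_gf_upto_topn; last exact: leq_trans lt_jm (leq_fibS _).
(* Here [fib j.+1] must be used: parts up to [fib j] cannot reach [2 * fib j.+1 + m]. *)
rewrite fib_gf_uptoS leq_addr addKn gf_avoid fib_gf_upto_eq0; last first.
  by rewrite fibSS; have := leq_fibS j; lia.
by rewrite (phiSr k.+1) !exprS; ring.
Qed.

(** * Recurrences along a 2-partition *)

(** All entries of [I] are at most [i - 2]; this supplies the size hypothesis of the gap lemmas. *)
Lemma two_partition_rcons_sum_lt I i : two_partition (rcons I i) ->
  (\sum_(j <- I) fib j < fib i.-1)%N.
Proof.
rewrite two_partition_rcons => /and3P[i_gt0 Ii I2].
case: i i_gt0 Ii => [|[|i]] // _ Ii.
  by case: I Ii {I2} => // _; rewrite big_nil.
exact: two_partition_sum_lt.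
Qed.

Lemma sum_fib_rcons I i :
  (\sum_(a <- rcons I i) fib a = fib i + \sum_(a <- I) fib a)%N.
Proof. by rewrite big_rcons addnC. Qed.

Lemma fib_gf_rcons_odd I j i : two_partition (rcons (rcons I j) i) ->
  odd i != odd j ->
  fib_gf (\sum_(a <- rcons (rcons I j) i) fib a) =
  phi ((i - j)./2.+1) * fib_gf (\sum_(a <- rcons I j) fib a).
Proof.
rewrite two_partition_rcons all_rcons => /and3P[_ /andP[le_ji _] Ij2] odd_ij.
have j_gt0 : (0 < j)%N by move: Ij2; rewrite two_partition_rcons => /andP[].
have := two_partition_rcons_sum_lt _ _ Ij2; rewrite !sum_fib_rcons.
case: j j_gt0 le_ji odd_ij {Ij2} => // j _ le_ji odd_ij lt_m.
(* The gap is odd and at least 2, hence at least 3. *)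
have [k ei] : exists k, i = (j.+1 + k.+1.*2.+1)%N.
  by exists ((i - j.+1)./2.-1); lia.
by rewrite ei addKn -uphalfE uphalf_double fib_gf_odd_gap.
Qed.

Lemma fib_gf_rcons_even I j i : two_partition (rcons (rcons I j) i) ->
  odd i = odd j ->
  fib_gf (\sum_(a <- rcons (rcons I j) i) fib a) =
  phi ((i - j)./2.+1) * fib_gf (\sum_(a <- rcons I j) fib a)
  - 'X^((i - j)./2.+2) * fib_gf (\sum_(a <- I) fib a).
Proof.
rewrite two_partition_rcons all_rcons => /and3P[_ /andP[le_ji _] Ij2] odd_ij.
have j_gt0 : (0 < j)%N by move: Ij2; rewrite two_partition_rcons => /andP[].
have := two_partition_rcons_sum_lt _ _ Ij2; rewrite !sum_fib_rcons.
case: j j_gt0 le_ji odd_ij {Ij2} => // j _ le_ji odd_ij lt_m.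
have [k ei] : exists k, i = (j.+1 + k.+1.*2)%N.
  by exists ((i - j.+1)./2.-1); lia.
by rewrite ei addKn doubleK fib_gf_even_gap.
Qed.

(** * Blocks of equal parity and the factors [D] *)

(** The predecessor [i] is arbitrary so that blocks after the first are covered. *)
Definition half_gaps (i : nat) (J : seq nat) : seq nat :=
  pairmap (fun a b => (b - a)./2.+1) i J.

Lemma assoc_vectorE I : assoc_vector I = half_gaps 1 I.
Proof. by case: I. Qed.

Lemma two_partition_catl I J : two_partition (I ++ J) -> two_partition I.
Proof.
elim/last_ind: J => [|J j IH]; rewrite ?cats0 // -rcons_cat.
by rewrite two_partition_rcons => /and3P[_ _ /IH].
Qed.

Lemma half_gaps_rcons i J j :
  half_gaps i (rcons J j) = rcons (half_gaps i J) ((j - last i J)./2.+1).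
Proof. by rewrite /half_gaps -cats1 pairmap_cat cats1. Qed.

Lemma sub_same_parity J K :
  {subset J <= K} -> same_parity K -> same_parity J.
Proof.
move=> sJK /allP Kpar; apply/allP => x /sJK /Kpar /allP xpar.
by apply/allP => y /sJK /xpar.
Qed.

(** Strong induction on the size of [J], as the recurrence of [D] goes back two entries. The change
    of parity makes the first entry of [J] contribute a plain factor [phi]; for empty [I] its gap is
    measured from 1. *)
Lemma fib_gf_cat_same_parity I J : two_partition (I ++ J) -> same_parity J ->
  (I != [::] -> J != [::] -> odd (last 1 I) != odd (head 0 J)) ->
  fib_gf (\sum_(a <- I ++ J) fib a) =
  fib_gf (\sum_(a <- I) fib a) * D (half_gaps (last 1 I) J).
Proof.
have [m] := ubnP (size J); elim: m J => // m IH J.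
case/lastP: J => [|J a]; first by rewrite cats0 D_nil mulr1.
case/lastP: J => [|J b] lt_m IJ2 Jpar IJodd.
  rewrite cats1 in IJ2 *; rewrite D_seq1.
  case/lastP: I {IH} IJ2 IJodd => [|I i] Ia2 IJodd.
    have := Ia2; rewrite two_partition_rcons => /andP[a_gt0 _].
    by rewrite big_seq1 big_nil fib_gf_fib // fib_gf0 mul1r.
  rewrite fib_gf_rcons_odd ?last_rcons 1?mulrC // eq_sym.
  by have := IJodd _ isT; rewrite last_rcons; apply; case: (I).
have sub : {subset rcons J b <= rcons (rcons J b) a}.
  by move=> x; rewrite [in X in _ -> X]mem_rcons inE orbC => ->.
have sub2 : {subset J <= rcons J b}.
  by move=> x; rewrite mem_rcons inE orbC => ->.
have odd_ab : odd a = odd b.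
  apply/eqP; have /allP/(_ a) := Jpar; rewrite mem_rcons mem_head => /(_ isT).
  by move/allP; apply; apply: sub; rewrite mem_rcons mem_head.
rewrite size_rcons ltnS in lt_m.
rewrite !half_gaps_rcons D_rcons2 last_rcons -!rcons_cat fib_gf_rcons_even //; last first.
  by rewrite !rcons_cat.
rewrite rcons_cat IH //; first last.
- by move=> I0 _; have := IJodd I0; case: (J) => [|? ?] /=; apply.
- exact: sub_same_parity sub Jpar.
- by move: IJ2; rewrite -cats1 catA; apply: two_partition_catl.
rewrite IH //; first last.
- by move=> I0 J0; have := IJodd I0; case: (J) J0 => [|? ?] //= _; apply.
- exact: sub_same_parity sub2 (sub_same_parity _ _ sub Jpar).
- by move: IJ2; rewrite -!cats1 -catA catA; apply: two_partition_catl.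
- by rewrite size_rcons in lt_m; lia.
by rewrite half_gaps_rcons mulrBr !(mulrCA (fib_gf _)).
Qed.

(** Stated for every canonical form so that the last block can be split off, whereas
    [canonical_form] recurses from the left. *)
Lemma fib_gf_canonical_form I Is : two_partition I -> is_canonical_form I Is ->
  fib_gf (\sum_(i <- I) fib i) =
  \prod_(B <- reshape (shape Is) (assoc_vector I)) D B.
Proof.
rewrite assoc_vectorE => I2 [eI].
elim/last_ind: Is I I2 eI => [|Is J IH] I I2 eI; rewrite -{I}eI in I2 *.
  by rewrite /= !big_nil fib_gf0.
rewrite flatten_rcons in I2 *; rewrite !all_rcons.
move=> /andP[J0 Is0] /andP[Jsim Iss] sIs.
have [{}sIs boundary] : sorted (fun J K =>
      (last 0 J < head 0 K)%N && odd (head 0 K - last 0 J)) Is /\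
    (Is != [::] -> odd (last 0 (last [::] Is)) != odd (head 0 J)).
  case: Is sIs {IH Is0 I2 Iss} => [|K Is] //=; rewrite rcons_path => /andP[-> /=].
  case/andP=> lt_KJ; rewrite oddB; last exact: ltnW.
  by move=> oddKJ; split=> // _; move: oddKJ; do 2!case: odd.
have sizeIs : size (half_gaps 1 (flatten Is)) = sumn (shape Is).
  by rewrite size_pairmap size_flatten.
rewrite /shape map_rcons -/(shape Is) reshape_rcons; last first.
  by rewrite size_pairmap size_cat size_flatten.
(* The first entry for [J] is measured from the last index before [J], so the vector splits at the
   block boundary. *)
rewrite {1 2}/half_gaps pairmap_cat -!/(half_gaps _ _) -sizeIs.
rewrite take_size_cat // drop_size_cat // big_rcons /=.
rewrite -(IH (flatten Is)) //; last exact: two_partition_catl I2.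
rewrite fib_gf_cat_same_parity //; first by case/andP: Jsim.
move=> nzI _; have nzIs : Is != [::] by case: (Is) nzI.
(* The last block [K] is nonempty, so its last entry ends the flattened sequence whatever the
   default of [last]. *)
move: nzIs (boundary nzIs) Is0.
case/lastP: Is {nzI boundary sIs sizeIs IH I2 Iss} => // Is K _ odd_KJ.
rewrite all_rcons => /andP[K0 _]; move: odd_KJ.
by rewrite flatten_rcons last_cat last_rcons; case: K K0.
Qed.

Theorem theorem1p4 (n : nat) (n_gt0 : (0 < n)%N) :
  fib_gf n = \prod_(B <- multivector (zeckendorf n)) D B.
Proof.
have /andP[Z2 /eqP {1}<-] := zeckendorfP n.
exact: fib_gf_canonical_form Z2 (canonical_formP Z2).
Qed.
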